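(* For every finite connected simple graph $G$ with $m$ edges and minimum degree $\delta$, $\widetilde{\mathsf{VC}}(G)\ge m-\delta$.
   Context: Unweighted deterministic walk: each vertex $u$ has a rotor sequence of length $\tilde d(u)$ of neighbours of $u$, each occurring exactly $\tilde d(u)/\deg(u)$ times (e.g. $\tilde d(u)=\deg(u)$ and the sequence is a permutation of the neighbours), and an initial rotor position. The walk moves from the current vertex $\tilde x_t$ to the vertex the rotor of $\tilde x_t$ points at, and then advances that rotor cyclically to the next entry of its sequence. $\widetilde{\mathsf{VC}}(G)$ is the maximum over start vertices $\tilde x_0$ and over all rotor sequences and initial rotor positions (lengths fixed) of the least $t\ge0$ with $\{\tilde x_0,\dots,\tilde x_t\}=V$. *)

(* Defs.v *)
From mathcomp Require Import all_boot.

Set Implicit Arguments.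
Unset Strict Implicit.
Unset Printing Implicit Defensive.

Record cgraph := CGraph {
  vertex :> finType;
  adj : rel vertex;
  adj_sym : symmetric adj;
  adj_irr : irreflexive adj;
  vertex_gt0 : 0 < #|vertex|;
  adj_conn : forall x y, connect adj x y }.

Definition deg (G : cgraph) (u : G) : nat := #|[set v | adj u v]|.

Definition edges (G : cgraph) : {set {set G}} :=
  [set [set z.1; z.2] | z : G * G & adj z.1 z.2].

(* The default #|G| exceeds every degree, so this is the minimum of the
   degrees since G is nonempty. *)
Definition min_deg (G : cgraph) : nat := \big[minn/#|G|]_(u : G) deg u.

(* The length is positive except at an isolated vertex, which has no neighbour
   to list; by connectedness this happens only in the one-vertex graph. *)
Record rotor_lengths (G : cgraph) := RotorLengths {
  len :> G -> nat;
  len_dvd : forall u, deg u %| len u;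
  len_gt0 : forall u, 0 < deg u -> 0 < len u }.

Section RotorWalk.

Variables (G : cgraph) (d : rotor_lengths G).

Definition rotor_seqs : finType :=
  {s : {dffun forall u : G, (d u).-tuple G} |
    [forall u, forall v,
      count_mem v (s u) == if adj u v then d u %/ deg u else 0]}.

(* Equal to 'I_(d u) unless d u = 0 (one-vertex graph), where a single dummy
   position remains so that the walk is still defined. *)
Definition position (u : G) : finType := 'I_(maxn 1 (d u)).

Definition positions : finType := {dffun forall u : G, position u}.

Definition state : finType := (G * positions)%type.

(* ordS is the successor modulo the length. The default of nth is reached only
   in the one-vertex graph. *)
Definition step (s : rotor_seqs) (z : state) : state :=
  (nth z.1 (val s z.1) (z.2 z.1),
   finfun (fun u => if u == z.1 then ordS (z.2 u) else z.2 u)).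

Definition walk (s : rotor_seqs) (p : positions) (x0 : G) (t : nat) : G :=
  (iter t (step s) (x0, p)).1.

Definition covered s p x0 t : bool :=
  [set walk s p x0 i | i : 'I_t.+1] == [set: G].

Lemma count_rotor (s : rotor_seqs) u v :
  count_mem v (val s u) = if adj u v then d u %/ deg u else 0.
Proof. by case: s => s /= /forallP/(_ u)/forallP/(_ v)/eqP. Qed.

Lemma mem_rotor (s : rotor_seqs) u v : adj u v -> v \in (val s u : seq G).
Proof.
move=> uv; have degu : 0 < deg u by apply/card_gt0P; exists v; rewrite inE.
rewrite -has_pred1 has_count count_rotor uv divn_gt0 //.
by apply: dvdn_leq; [apply: len_gt0 | apply: len_dvd].
Qed.

Lemma exists_covered s p x0 : exists t, covered s p x0 t.
Proof.
set st := fun n => iter n (step s) (x0, p).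
have stS n : st n.+1 = step s (st n) by [].
have [N [k [k_gt0 per]]] : exists N k, 0 < k /\
    forall n, N <= n -> st (n + k) = st n.
  have : ~ injective (fun i : 'I_(#|state|.+1) => st i).
    by move=> /leq_card; rewrite card_ord ltnn.
  move/injectiveP/injectivePn => [i [j neq_ij eq_ij]].
  wlog lt_ij : i j neq_ij eq_ij / i < j.
    move=> W; case: (ltngtP i j) => [||/val_inj eqij]; [exact: W | | ].
      by apply: W; rewrite // eq_sym.
    by rewrite eqij eqxx in neq_ij.
  exists i, (j - i); split; first by rewrite subn_gt0.
  move=> n le_in; rewrite -(subnK le_in) -addnA subnKC 1?ltnW //.
  by rewrite /st !iterD -/(st i) -/(st j) eq_ij.
pose rec u := exists2 n, N <= n & (st n).1 = u.
have next u n : N <= n -> (st n).1 = u ->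
    exists2 n', N <= n' & (st n').1 = u /\ (st n').2 u = ordS ((st n).2 u).
  move=> leNn stn.
  have ex : exists j, (st (n + j.+1)).1 == u.
    by exists k.-1; rewrite prednK // per // stn.
  case: (ex_minnP ex) => j /eqP stj jmin.
  exists (n + j.+1); first by rewrite (leq_trans leNn) ?leq_addr.
  split=> //.
  have : forall i, i <= j -> (st (n + i.+1)).2 u = ordS ((st n).2 u).
    elim=> [|i IHi] lei; first by rewrite addn1 stS /step /= ffunE stn eqxx.
    rewrite addnS stS /step /= ffunE ifN; first by apply/IHi/ltnW.
    by apply/eqP => /esym/eqP/jmin; rewrite leqNgt lei.
  by apply.
have all_pos u n q : N <= n -> (st n).1 = u ->
    exists2 n', N <= n' & (st n').1 = u /\ (st n').2 u = iter q (@ordS _) ((st n).2 u).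
  move=> leNn stn; elim: q => [|q [n' leNn' [stn' posn']]]; first by exists n.
  have [m leNm [stm posm]] := next u n' leNn' stn'.
  by exists m => //; split=> //; rewrite posm posn'.
have rec_adj u v : rec u -> adj u v -> rec v.
  move=> [n leNn stn] /(mem_rotor s) v_in.
  set i := index v (val s u); have lti : i < d u by rewrite -[d u in X in _ < X](size_tuple (val s u)) index_mem.
  have d1 : maxn 1 (d u) = d u by apply/maxn_idPr/(leq_trans _ lti).
  set q0 := (st n).2 u.
  have iterE q : iter q (@ordS _) q0 = (q0 + q) %% d u :> nat.
    elim: q => [|q IHq] /=; first by rewrite addn0 modn_small // -[X in _ < X]d1.
    by rewrite IHq [X in _ %% X]d1 -addn1 modnDml addn1 addnS.
  have [n' leNn' [stn' pos']] := all_pos u n (d u - q0 + i) leNn stn.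
  exists n'.+1; first exact: leqW.
  rewrite stS /step /= stn' pos' iterE addnA subnKC; last first.
    by rewrite -[X in _ <= X]d1 ltnW.
  by rewrite modnDl modn_small // nth_index.
have rec_all v : rec v.
  have /connectP[c path_c ->] := adj_conn (st N).1 v.
  have : rec (st N).1 by exists N.
  elim: c (st N).1 path_c => //= w c IHc u /andP[uw path_c] recu.
  exact: IHc path_c (rec_adj _ _ recu uw).
have ex_time v : exists n, (st n).1 == v.
  by have [n _ stn] := rec_all v; exists n; apply/eqP.
exists (\max_v ex_minn (ex_time v)); apply/eqP/setP => v; rewrite inE.
apply/imsetP; pose tv := ex_minn (ex_time v).
have lt_tv : tv < (\max_v ex_minn (ex_time v)).+1 by rewrite ltnS leq_bigmax.
exists (Ordinal lt_tv) => //=; rewrite /walk -/(st tv).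
by rewrite /tv; case: ex_minnP => n /eqP->.
Qed.

Definition cover_time s p x0 : nat := ex_minn (exists_covered s p x0).

Definition VC : nat :=
  \max_(x0 : G) \max_(s : rotor_seqs) \max_(p : positions) cover_time s p x0.

End RotorWalk.

(* Main.v *)
Require Import Defs.
From mathcomp Require Import all_boot.
From mathcomp Require Import zify.

(** Let [T] be a longest closed trail among those that start at a fixed vertex,
    miss some vertex, and grow from the empty trail by detours [x -> y -> x]
    along unused edges. A detour adds two arcs, one edge and at most one vertex,
    so [T] has at least twice as many arcs as edges, and at least
    [2 (k - 1)] arcs if it visits [k] vertices. By maximality [T] misses exactly one vertex [w]
    and uses every edge that avoids [w]; hence
    [m <= |T| / 2 + deg w <= |T| / 2 + (n - 1) <= |T| + 1]. Since the arcs
    of [T] are distinct, suitable rotor sequences make the walk follow [T],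
    which does not visit [w]: the cover time exceeds [|T| >= m - 1]. *)

Set Implicit Arguments.
Unset Strict Implicit.
Unset Printing Implicit Defensive.

Lemma size_flatten_nseq (T : Type) k (s : seq T) :
  size (flatten (nseq k s)) = k * size s.
Proof. by rewrite size_flatten /shape map_nseq sumn_nseq mulnC. Qed.

Lemma count_flatten_nseq (T : Type) (a : pred T) k (s : seq T) :
  count a (flatten (nseq k s)) = k * count a s.
Proof. by rewrite count_flatten map_nseq sumn_nseq mulnC. Qed.

(** * Arcs and edges of a walk *)

Section Trails.

Variable T : finType.
Implicit Types (x y : T) (p : seq T).

Definition arcs x p : seq (T * T) := pairmap pair x p.

Definition trail_edges x p : {set {set T}} :=
  [set [set z.1; z.2] | z in arcs x p].

Lemma arcs_path (e : rel T) x p :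
  path e x p = all (fun z => e z.1 z.2) (arcs x p).
Proof. by elim: p x => //= y p IHp x; rewrite IHp. Qed.

Lemma unzip1_arcs x p : unzip1 (arcs x p) = belast x p.
Proof. by elim: p x => //= y p IHp x; rewrite IHp. Qed.

Lemma detour_arcs x0 p1 p2 y (x := last x0 p1) :
  perm_eq (arcs x0 (p1 ++ y :: x :: p2))
          [:: (x, y), (y, x) & arcs x0 (p1 ++ p2)].
Proof.
rewrite /arcs !pairmap_cat /= -/x.
by rewrite (perm_catCA _ [:: (x, y); (y, x)]).
Qed.

Lemma connect_boundary (e : rel T) (S : {pred T}) x y :
    connect e x y -> x \in S -> y \notin S ->
  exists u v, [/\ u \in S, v \notin S & e u v].
Proof.
move=> /connectP[p]; elim: p x => [|z p IHp] x /=.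
  by move=> _ -> ->.
move=> /andP[exz pz] yE xS yS; have [zS|zS] := boolP (z \in S).
  exact: IHp pz yE zS yS.
by exists x, z.
Qed.

End Trails.

(** * Closed trails and their detours *)

Section Graph.

Variable G : cgraph.
Implicit Types (x y u v w : G) (p : seq G).

(** The last two conjuncts are the invariants of growth by detours: at least two arcs per edge used,
    and at least two per visited vertex other than the start. [#|x :: p|] counts distinct
    vertices. *)
Definition closed_trail x p : bool :=
  [&& path (@adj G) x p, last x p == x, uniq (arcs x p),
      (#|trail_edges x p|).*2 <= size p
    & #|x :: p|.*2 <= (size p).+2].

Lemma closed_trail_detour x0 p x y :
    closed_trail x0 p -> x \in x0 :: p -> adj x y ->
    [set x; y] \notin trail_edges x0 p ->
  exists q, [/\ closed_trail x0 q, size q = (size p).+2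
              & x0 :: q =i y :: x0 :: p].
Proof.
move=> /and5P[pp lp up Ep Sp] xp xy; case/splitPl: xp pp lp up Ep Sp => p1 p2.
move=> lx pp lp up Ep Sp xyE; exists (p1 ++ y :: x :: p2).
have perm_q := detour_arcs x0 p1 p2 y; rewrite /= lx in perm_q.
have szq : size (p1 ++ y :: x :: p2) = (size (p1 ++ p2)).+2.
  by rewrite !size_cat /= !addnS.
have memq : x0 :: p1 ++ y :: x :: p2 =i [:: y, x0 & p1 ++ p2].
  have := mem_last x0 p1; rewrite lx => x1 z; move: x1.
  rewrite !inE !mem_cat !inE.
  case: (z =P x) => [->|_] x1.
    by case/orP: x1 => ->; rewrite ?orbT.
  by case: (z == y); case: (z == x0); case: (z \in p1); case: (z \in p2).
split=> //; apply/and5P; split.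
- move: pp; rewrite !cat_path /= lx => /andP[-> ->].
  by rewrite xy adj_sym xy.
- by move: lp; rewrite !last_cat lx /=.
- rewrite (perm_uniq perm_q) /= up andbT inE negb_or.
  rewrite xpair_eqE negb_and; apply/andP; split; last first.
    apply: contra xyE => yxp; apply/imsetP; exists (y, x) => //.
    by rewrite setUC.
  apply/andP; split; last first.
    by apply: contra xyE => xyp; apply/imsetP; exists (x, y).
  (* The graph has no loops, so the two inserted arcs differ from each other. *)
  by case: eqP xy => // ->; rewrite adj_irr.
- rewrite szq; suff sub : trail_edges x0 (p1 ++ y :: x :: p2) \subset
      [set x; y] |: trail_edges x0 (p1 ++ p2).
    have := subset_leq_card sub; rewrite cardsU1 xyE add1n -leq_double.
    by move=> /leq_trans; apply; rewrite doubleS !ltnS.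
  apply/subsetP => f /imsetP[z]; rewrite (perm_mem perm_q) !inE.
  case/or3P => [/eqP->|/eqP->|zp] ->; rewrite /= ?eqxx //.
    by rewrite [[set y; x]]setUC eqxx.
  by apply/orP; right; apply/imsetP; exists z.
rewrite szq (eq_card memq).
have -> : #|[:: y, x0 & p1 ++ p2]| =
    (y \notin x0 :: p1 ++ p2) + #|x0 :: p1 ++ p2|.
  rewrite -(cardU1 y (mem (x0 :: p1 ++ p2))).
  by apply: eq_card => z; rewrite !inE.
by rewrite doubleD -[X in _ <= X]add2n leq_add // (leq_double _ 1) leq_b1.
Qed.

(** * Degrees and edge counts *)

Lemma deg_gt0 u : 1 < #|G| -> 0 < deg u.
Proof.
move=> G1; have /card_gt0P[v] : 0 < #|predC1 u|.
  by have := cardC1 u; lia.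
rewrite inE => /= vu.
have [|//|a [b [+ _ ab]]] := connect_boundary (S := pred1 u) (adj_conn u v).
  by rewrite inE.
rewrite inE => /eqP au; apply/card_gt0P; exists b.
by rewrite inE -au.
Qed.

Lemma min_deg_gt0 : 1 < #|G| -> 0 < min_deg G.
Proof.
move=> G1; rewrite /min_deg; elim/big_ind: _ => [|a b a0 b0|u _].
- exact: ltnW.
- by rewrite leq_min a0.
- exact: deg_gt0.
Qed.

Lemma deg_lt_card u : deg u < #|G|.
Proof.
rewrite -cardsT; apply: proper_card; apply/properP; split.
  exact: subsetT.
by exists u; rewrite !inE ?adj_irr.
Qed.

(** An edge either joins [w] to one of its [deg w] neighbours or lies in [F]. *)
Lemma card_edges_avoiding w (F : {set {set G}}) :
    (forall x y, x != w -> y != w -> adj x y -> [set x; y] \in F) ->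
  #|edges G| <= deg w + #|F|.
Proof.
move=> EF; pose Ew := [set [set w; v] | v in [set v | adj w v]].
apply: leq_trans (_ : #|Ew :|: F| <= _); last first.
  rewrite cardsU; apply: leq_trans (leq_subr _ _) _.
  by rewrite leq_add2r leq_imset_card.
apply/subset_leq_card/subsetP => f /imsetP[[x y]]; rewrite inE /= => xy ->.
rewrite inE; have [xw|xw] := eqVneq x w.
  by apply/orP; left; apply/imsetP; exists y; rewrite ?inE -?xw.
have [yw|yw] := eqVneq y w; last by rewrite EF ?orbT.
apply/orP; left; apply/imsetP; exists x; first by rewrite inE -yw adj_sym.
by rewrite -yw setUC.
Qed.

(** * A longest closed trail that misses a vertex *)

Lemma long_trail : 1 < #|G| ->
  exists x0 p w, [/\ path (@adj G) x0 p, uniq (arcs x0 p), w \notin x0 :: p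
                   & #|edges G| <= (size p).+1].
Proof.
move=> G1; have /card_gt0P[x0 _] := vertex_gt0 G.
(* Fixing the length keeps the quantifier finite, so [P] is boolean and a maximal length can be
   extracted. *)
pose P n := [exists p : n.-tuple G,
  closed_trail x0 p && [exists w, w \notin x0 :: p]].
have PI p w : closed_trail x0 p -> w \notin x0 :: p -> P (size p).
  move=> tp wp; apply/existsP; exists (in_tuple p); rewrite tp /=.
  by apply/existsP; exists w.
have exP : exists n, P n.
  have /card_gt0P[w] : 0 < #|predC1 x0| by have := cardC1 x0; lia.
  rewrite inE => /= wx; exists 0; apply: (PI [::] w); last by rewrite inE.
  apply/and5P; split=> //=; last by rewrite (leq_double _ 1) card_size.
  rewrite leqn0 double_eq0 cards_eq0.
  by apply/eqP/setP => f; rewrite inE; apply/imsetP => -[].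
(* Lengths are bounded because the arcs are distinct. *)
have ubP n : P n -> n <= #|{: G * G}|.
  move=> /existsP[p /andP[/and5P[_ _ up _ _] _]].
  have /card_uniqP := up; rewrite size_pairmap size_tuple => <-.
  exact: max_card.
case: (ex_maxnP exP ubP) => n /existsP[p /andP[tp /existsP[w0 w0p]]] nmax.
have nE : n = size p by rewrite size_tuple.
have pmax q w : closed_trail x0 q -> size q = (size p).+2 -> w \in x0 :: q.
  move=> tq szq; apply: contraT => wq.
  by have := nmax _ (PI q w tq wq); rewrite szq -nE; lia.
have [||x [w [xp wp xw]]] :=
  connect_boundary (S := mem (x0 :: p)) (adj_conn x0 w0).
- by rewrite inE eqxx.
- exact: w0p.
exists x0, p, w; have /and5P[pp _ up Ep Sp] := tp; split=> //.
have edge_notin a b : b \notin x0 :: p -> [set a; b] \notin trail_edges x0 p.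
  apply: contra => /imsetP[[c e] /= ce] /setP/(_ b).
  rewrite !inE eqxx orbT => /esym/orP[] /eqP->.
    have : c \in unzip1 (arcs x0 p) by apply/mapP; exists (c, e).
    by rewrite unzip1_arcs => /mem_belast.
  have : e \in unzip2 (arcs x0 p) by apply/mapP; exists (c, e).
  suff -> : unzip2 (arcs x0 p) = p by move=> ->; rewrite orbT.
  by elim: (p : seq G) (x0) => //= y q IHq z; rewrite IHq.
have allS z : z != w -> z \in x0 :: p.
  move=> zw; have [q [tq szq memq]] :=
    closed_trail_detour tp xp xw (edge_notin x w wp).
  by have := pmax q z tq szq; rewrite memq inE (negPf zw).
(* Otherwise a detour along this edge would give a longer trail that still misses [w]. *)
have allE y z : y != w -> z != w -> adj y z -> [set y; z] \in trail_edges x0 p.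
  move=> yw zw yz; apply: contraT => yzE.
  have [q [tq szq memq]] := closed_trail_detour tp (allS y yw) yz yzE.
  have := pmax q w tq szq; rewrite memq inE (negPf wp) orbF.
  by move=> /eqP wz; rewrite wz eqxx in zw.
have leG : #|G|.-1 <= #|x0 :: p|.
  rewrite -(cardC1 w); apply/subset_leq_card/subsetP => z.
  by rewrite inE; apply: allS.
(* With [E] trail edges and [k] visited vertices, [m <= deg w + E <= k + E], while [2 E <= size p]
   and [2 k <= size p + 2]. *)
have := card_edges_avoiding allE; have := deg_lt_card w.
move: Ep Sp leG; lia.
Qed.

(** * Rotors that steer the walk along a trail *)

Section Rotors.

Variables (d : rotor_lengths G) (x0 : G) (p : seq G).
Hypothesis G1 : 1 < #|G|.
Hypotheses (adj_p : path (@adj G) x0 p) (uniq_p : uniq (arcs x0 p)).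

Definition exits u : seq G := [seq z.2 | z <- arcs x0 p & z.1 == u].

Lemma exits_uniq u : uniq (exits u).
Proof.
rewrite map_inj_in_uniq ?filter_uniq // => -[a b] [c e].
by rewrite !mem_filter /= => /andP[/eqP-> _] /andP[/eqP-> _] ->.
Qed.

Lemma exits_adj u v : v \in exits u -> adj u v.
Proof.
case/mapP => z; rewrite mem_filter => /andP[/eqP<- zp] ->.
by move: adj_p; rewrite arcs_path => /allP/(_ z zp).
Qed.

(** The exits come first, in trail order. They are distinct neighbours, so the second block
    completes them to one copy of [N]; the remaining copies give the required multiplicity. *)
Definition trail_rotor u : seq G :=
  let N := enum [set v | adj u v] in
  exits u ++ [seq v <- N | v \notin exits u]
    ++ flatten (nseq (d u %/ deg u).-1 N).

Lemma quot_gt0 u : 0 < d u %/ deg u.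
Proof.
have du := deg_gt0 u G1; rewrite divn_gt0 //.
by apply: dvdn_leq; [apply: len_gt0 | apply: len_dvd].
Qed.

Lemma trail_rotor_perm u :
  perm_eq (trail_rotor u)
          (flatten (nseq (d u %/ deg u) (enum [set v | adj u v]))).
Proof.
rewrite -(prednK (quot_gt0 u)) /= /trail_rotor catA perm_cat2r.
apply: uniq_perm; rewrite ?enum_uniq //.
  rewrite cat_uniq exits_uniq filter_uniq ?enum_uniq // andbT.
  by apply/hasPn => v; rewrite mem_filter => /andP[].
move=> v; rewrite mem_cat mem_filter mem_enum inE.
by case: (boolP (v \in exits u)) => [/exits_adj->|].
Qed.

Lemma size_trail_rotor u : size (trail_rotor u) == d u.
Proof.
rewrite (perm_size (trail_rotor_perm u)) size_flatten_nseq -cardE.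
by rewrite divnK ?len_dvd.
Qed.

Definition trail_rotor_fun : {dffun forall u : G, (d u).-tuple G} :=
  [ffun u => Tuple (size_trail_rotor u)].

Lemma trail_rotorsP :
  [forall u, forall v,
    count_mem v (trail_rotor_fun u) == if adj u v then d u %/ deg u else 0].
Proof.
apply/forallP => u; apply/forallP => v; rewrite ffunE /=.
rewrite (permP (trail_rotor_perm u)) count_flatten_nseq.
rewrite count_uniq_mem ?enum_uniq // mem_enum inE.
by case: (adj u v); rewrite ?muln1 ?muln0.
Qed.

Definition trail_rotors : rotor_seqs d := Sub trail_rotor_fun trail_rotorsP.

Definition start_positions : positions d :=
  [ffun u => Ordinal (leq_maxl 1 (d u) : 0 < maxn 1 (d u))].

(** The induction carries the rotor positions along: each rotor has advanced once per departure from
    its vertex. *)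
Lemma walk_trail t (z := iter t (step trail_rotors) (x0, start_positions)) :
    t <= size p ->
  z.1 = nth x0 (x0 :: p) t /\
  forall u, z.2 u = count_mem u (take t (belast x0 p)) %% maxn 1 (d u) :> nat.
Proof.
rewrite {}/z; elim: t => [|t IHt] lt_tp /=.
  by split=> // u; rewrite ffunE take0 mod0n.
have [] := IHt (ltnW lt_tp).
case: (iter t _ _) => x q /= -> {x} posq.
set x := nth x0 (x0 :: p) t.
have lt_tb : t < size (belast x0 p) by rewrite size_belast.
have xE : nth x0 (belast x0 p) t = x.
  by rewrite /x lastI nth_rcons lt_tb.
split; last first.
  move=> u; rewrite ffunE (take_nth x0 lt_tb) xE -cats1 count_cat /= addn0.
  case: (eqVneq u x) => [->|_]; last by rewrite addn0.
  by rewrite /= posq -addn1 modnDml.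
have lt_ta : t < size (arcs x0 p) by rewrite size_pairmap.
pose a := nth (x0, x0) (arcs x0 p) t.
have aE : a = (x, nth x0 p t) by rewrite /a (nth_pairmap x0).
pose c := count_mem x (take t (belast x0 p)).
pose e := [seq z.2 | z <- take t (arcs x0 p) & z.1 == x].
(* [e] lists the exits from [x] before time [t], so the exit due at time [t] has index
   [size e = c]. *)
have [r exE] : exists r, exits x = e ++ nth x0 p t :: r.
  rewrite /exits -{1}(cat_take_drop t (arcs x0 p)) (drop_nth (x0, x0)) //.
  by rewrite -/a aE filter_cat map_cat /= eqxx /=; eexists.
have cE : size e = c.
  by rewrite size_map size_filter /c -unzip1_arcs -map_take count_map.
have rotE : trail_rotor x = e ++ nth x0 p t ::
    (r ++ drop (size (exits x)) (trail_rotor x)).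
  by rewrite {1}/trail_rotor {1}exE drop_size_cat // -catA.
(* The rotor at [x] has not wrapped around, so its position is [c] itself. *)
have lt_cd : c < d x.
  rewrite -(eqP (size_trail_rotor x)) rotE size_cat cE /= addnS ltnS.
  exact: leq_addr.
rewrite posq modn_small; last by rewrite leq_max lt_cd orbT.
by rewrite ffunE /= rotE nth_cat cE ltnn subnn.
Qed.

Lemma trail_lt_VC w : w \notin x0 :: p -> size p < VC d.
Proof.
move=> wp; pose T := cover_time trail_rotors start_positions x0.
apply: (@leq_trans T); last first.
  apply: leq_trans (leq_bigmax x0); apply: leq_trans (leq_bigmax trail_rotors).
  exact: leq_bigmax.
rewrite /T /cover_time; case: ex_minnP => t /eqP/setP/(_ w) + _.
(* Were the cover time at most [size p], the visit to [w] would happen on the trail. *)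
rewrite inE => /imsetP[i _ wE]; rewrite ltnNge; apply: contra wp => le_tp.
have le_ip : i <= size p by apply: leq_trans le_tp; rewrite -ltnS.
by rewrite wE /walk (walk_trail le_ip).1 mem_nth.
Qed.

End Rotors.

End Graph.

(** * The lower bound on the cover time *)

Theorem theorem4p1 (G : cgraph) (d : rotor_lengths G) :
  #|edges G| - min_deg G <= VC d.
Proof.
(* A one-vertex graph has no edge; otherwise the trail gives [m <= size p + 1 <= VC d]. *)
have [G1|G1] := leqP #|G| 1.
  have [w _] := card_gt0P (vertex_gt0 G).
  suff -> : edges G = set0 by rewrite cards0.
  apply/setP => f; rewrite inE; apply/imsetP => -[[x y]]; rewrite inE /=.
  by rewrite (card_le1_eqP G1 x y) // adj_irr.
have [x0 [p [w [adj_p uniq_p wp edges_le]]]] := long_trail G1.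
have := trail_lt_VC d G1 adj_p uniq_p wp; have := min_deg_gt0 G1.
move: edges_le; lia.
Qed.
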